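(* For each integer $k\ge 0$, let $\{(a_n,b_n)\}_{n\ge 0}$ be the $k$-sequence of $\mathcal{F}$-Wythoff. Then $a_n=\mathrm{mex}\{a_i,b_i\mid 0\le i<n\}$ for each $n$.
   Context: $\lfloor\cdot\rfloor$ is the integer part. A position is an unordered pair $(a,b)$ of nonnegative integers (two piles of tokens); $(a,b)$ is identified with $(b,a)$. $\mathcal{F}$-Wythoff is the impartial game with the following legal moves: (i) remove any positive number of tokens from one pile; (ii) remove the same positive number $k$ of tokens from both piles, provided the integer ratio of the two entries does not change, i.e. from $(a,b)$ with $1\le a\le b$ one may move to $(a-k,b-k)$ with $1\le k<a$ if $\lfloor (b-k)/(a-k)\rfloor=\lfloor b/a\rfloor$. The followers of $p$ are the positions reachable from $p$ by one legal move. For a finite set $S$ of nonnegative integers, $\mathrm{mex}(S)$ is the smallest nonnegative integer not in $S$ (so $\mathrm{mex}\,\emptyset=0$). The Sprague-Grundy value is defined inductively by $\mathcal{G}(p)=\mathrm{mex}\{\mathcal{G}(q)\mid q \text{ is a follower of } p\}$. The $k$-sequence of $\mathcal{F}$-Wythoff is the sequence $\{(a_n,b_n)\}_{n\ge 0}$ of all positions whose Sprague-Grundy value is $k$, written so that $0\le a_n\le b_n$ and $a_n<a_m$ for $n<m$. *)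

(* Defs.v *)
From mathcomp Require Import all_boot.
From mathcomp Require Import zify.

Set Implicit Arguments.
Unset Strict Implicit.
Unset Printing Implicit Defensive.

(* Finite sets of naturals are given by sequences, up to order and
   repetition. *)
Lemma mex_subproof (s : seq nat) : exists n, n \notin s.
Proof.
exists (foldr maxn 0 s).+1; apply/negP => h.
suff: forall x, x \in s -> x <= foldr maxn 0 s by move/(_ _ h); rewrite ltnn.
elim: s {h} => //= y s IH x; rewrite inE => /orP[/eqP->|/IH]; lia.
Qed.

Definition mex (s : seq nat) : nat := ex_minn (mex_subproof s).

Lemma mex_notin (s : seq nat) : mex s \notin s.
Proof. by rewrite /mex; case: ex_minnP. Qed.

Lemma lt_mex (s : seq nat) (i : nat) : i < mex s -> i \in s.
Proof.
by rewrite /mex; case: ex_minnP => m _ hm hi; apply/negPn/negP => /hm; lia.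
Qed.

(* An unordered pair {x, y} is encoded by its sorted representative. *)
Definition position := {p : nat * nat | p.1 <= p.2}.

Lemma pos_subproof (x y : nat) : (minn x y, maxn x y).1 <= (minn x y, maxn x y).2.
Proof. rewrite /=; lia. Qed.

Definition pos (x y : nat) : position := exist _ (minn x y, maxn x y) (pos_subproof x y).

Lemma posC (x y : nat) : pos x y = pos y x.
Proof. by apply/val_inj; rewrite /= minnC maxnC. Qed.

(* The move on both piles requires t < a, so it never empties a pile and the
   ratio after the move is always a genuine quotient. *)
Definition followers (p : position) : seq position :=
  let: (a, b) := val p in
  [seq pos (a - t) b | t <- iota 1 a] ++
  [seq pos a (b - t) | t <- iota 1 b] ++
  [seq pos (a - t) (b - t) | t <- iota 1 a.-1 & (b - t) %/ (a - t) == b %/ a].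

(* The first argument is fuel; each move decreases the number of tokens, so
   [grundyE] below is the defining recursion. *)
Fixpoint grundy_fuel (n : nat) (p : position) : nat :=
  if n is n'.+1 then mex [seq grundy_fuel n' q | q <- followers p] else 0.

Definition tokens (p : position) : nat := (val p).1 + (val p).2.

Definition grundy (p : position) : nat := grundy_fuel (tokens p).+1 p.

Arguments grundy : simpl never.

Lemma followers_tokens (p q : position) : q \in followers p -> tokens q < tokens p.
Proof.
case: p => -[a b] /= ab; rewrite /followers /tokens /= !mem_cat.
case/or3P => /mapP[t]; rewrite ?mem_filter mem_iota => ht -> /=; lia.
Qed.

Lemma grundyE (p : position) : grundy p = mex [seq grundy q | q <- followers p].
Proof.
suff fuelE n m r : tokens r < n -> tokens r < m -> grundy_fuel n r = grundy_fuel m r.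
  rewrite {1}/grundy /=; congr mex; apply/eq_in_map => q /followers_tokens hq.
  by apply: fuelE; lia.
elim: n m r => [|n IH] [|m] r //= hn hm.
congr mex; apply/eq_in_map => q /followers_tokens hq; apply: IH; lia.
Qed.

Definition is_k_sequence (k : nat) (a b : nat -> nat) : Prop :=
  [/\ forall n, a n <= b n,
      forall n m, n < m -> a n < a m
    & forall p, grundy p = k <-> exists n, p = pos (a n) (b n)].

Lemma grundy_follower (p q : position) : q \in followers p -> grundy q <> grundy p.
Proof.
move=> hq e; have := mex_notin [seq grundy r | r <- followers p].
by rewrite -grundyE -e => /negP; apply; apply/map_f.
Qed.

Lemma followers_pos (x y : nat) : x <= y ->
  followers (pos x y) =
  [seq pos (x - t) y | t <- iota 1 x] ++
  [seq pos x (y - t) | t <- iota 1 y] ++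
  [seq pos (x - t) (y - t) | t <- iota 1 x.-1 & (y - t) %/ (x - t) == y %/ x].
Proof.
by move=> xy; rewrite /followers /pos /=; move/minn_idPl: (xy) => ->; move/maxn_idPr: xy => ->.
Qed.

Lemma mem_followers_row (x y z : nat) : z < y -> pos x z \in followers (pos x y).
Proof.
move=> zy; case: (leqP x y) => xy; last rewrite posC (posC x y).
- rewrite followers_pos // !mem_cat; apply/orP; right; apply/orP; left.
  apply/mapP; exists (y - z); first by rewrite mem_iota; lia.
  by congr pos; lia.
- rewrite followers_pos ?(ltnW xy) // !mem_cat; apply/orP; left.
  apply/mapP; exists (y - z); first by rewrite mem_iota; lia.
  by congr pos; lia.
Qed.

Lemma grundy_row_inj (x y z : nat) : grundy (pos x y) = grundy (pos x z) -> y = z.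
Proof.
by move=> e; case: (ltngtP y z) => // /(mem_followers_row x)/grundy_follower; rewrite e.
Qed.

Lemma grundy_row_surj (k x : nat) : exists y, grundy (pos x y) == k.
Proof.
elim/ltn_ind: x => x IH.
have [D hD] : exists D, forall c, c < x -> forall d, D <= d -> grundy (pos c d) <> k.
  have: forall c, c < x -> exists D, forall d, D <= d -> grundy (pos c d) <> k.
    move=> c /IH[y /eqP hy]; exists y.+1 => d hd.
    by rewrite -hy => /grundy_row_inj; lia.
  elim: (x) => [|n IHn] h; first by exists 0.
  have [|D hD] := IHn; first by move=> c hc; apply: h; lia.
  have [//|E hE] := h n; exists (maxn D E) => c hc d hd.
  by case: (eqVneq c n) => [->|ne]; [apply: hE|apply: hD]; lia.
pose B := D + x.+1.
have [/hasP[y _ hy]|no] := boolP (has (fun y => grundy (pos x y) == k) (iota 0 (B + k.+1))).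
  by exists y.
have {}no y : y < B + k.+1 -> grundy (pos x y) <> k.
  by move=> hy /eqP e; move/hasP: no; apply; exists y => //; rewrite mem_iota.
have lt_k y : B <= y < B + k.+1 -> grundy (pos x y) < k.
  move=> hy; have ne : grundy (pos x y) <> k by apply: no; lia.
  have [//|gt|//] := ltngtP (grundy (pos x y)) k.
  move: gt; rewrite grundyE => /lt_mex /mapP[q].
  rewrite followers_pos; last by rewrite /B in hy; lia.
  rewrite !mem_cat => /or3P[] /mapP[t]; rewrite ?mem_filter mem_iota => ht -> e.
  - by case: (hD (x - t) _ y _ (esym e)); lia.
  - by case: (no (y - t) _ (esym e)); lia.
  - by case: (hD (x - t) _ (y - t) _ (esym e)); lia.
have: size [seq grundy (pos x y) | y <- iota B k.+1] <= size (iota 0 k).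
  apply: uniq_leq_size; first by rewrite map_inj_uniq ?iota_uniq // => y z /grundy_row_inj.
  move=> v /mapP[y]; rewrite !mem_iota => hy ->; have := lt_k y; lia.
by rewrite size_map !size_iota ltnn.
Qed.

Definition partner (k x : nat) : nat := ex_minn (grundy_row_surj k x).

Lemma partnerP (k x y : nat) : grundy (pos x y) = k <-> y = partner k x.
Proof.
rewrite /partner; case: ex_minnP => z /eqP hz _; split=> [|-> //].
by rewrite -{1}hz => /grundy_row_inj.
Qed.

Lemma partnerK (k x : nat) : partner k (partner k x) = x.
Proof. by apply/esym/partnerP; rewrite posC; apply/partnerP. Qed.

Lemma partner_infinite (k N : nat) : exists x, (N <= x) && (x <= partner k x).
Proof.
have [/hasP[x]|no] := boolP (has (fun x => x <= partner k x)
   (iota N N.+1 ++ [seq partner k x | x <- iota N N.+1 & N <= partner k x])).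
  rewrite mem_cat => hx le; exists x; rewrite le andbT.
  by case/orP: hx => [|/mapP[y]]; rewrite ?mem_filter mem_iota => hy; [lia|move=> ->; lia].
have: size [seq partner k x | x <- iota N N.+1] <= size (iota 0 N).
  apply: uniq_leq_size.
    by rewrite map_inj_uniq ?iota_uniq //; exact: (can_inj (partnerK k)).
  move=> v /mapP[x hx ->]; rewrite mem_iota /= add0n ltnNge; apply/negP => le.
  have h1 : ~~ (x <= partner k x).
    by apply: contra no => h; apply/hasP; exists x => //; rewrite mem_cat hx.
  move/hasP: no; apply; exists (partner k x); last by rewrite partnerK; lia.
  by rewrite mem_cat; apply/orP; right; apply/map_f; rewrite mem_filter le.
by rewrite size_map !size_iota ltnn.
Qed.

Lemma k_sequence_exists (k : nat) : exists a b, is_k_sequence k a b.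
Proof.
pose next N := ex_minn (partner_infinite k N).
have nextP N : N <= next N <= partner k (next N).
  by rewrite /next; case: ex_minnP.
have next_min N x : N <= x <= partner k x -> next N <= x.
  by rewrite /next; case: ex_minnP => m _; apply.
pose a := fix a n := if n is n'.+1 then next (a n').+1 else next 0.
have aS n : a n < a n.+1 by have := nextP (a n).+1; rewrite /=; lia.
have a_le n : a n <= partner k (a n).
  by case: n => [|n] /=; [have := nextP 0 | have := nextP (a n).+1]; lia.
have a_ge n : n <= a n by elim: n => // n IH; have := aS n; lia.
have a_onto n x : x <= partner k x -> x < a n -> exists i, x = a i.
  elim: n => [|n IH] hx /= lt; first by have := next_min 0 x; lia.
  case: (ltngtP x (a n)) => [| gt | ->]; [exact: IH | | by exists n].
  by have := next_min (a n).+1 x; lia.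
exists a, (fun n => partner k (a n)); split=> //.
  move=> n m; elim: m => // m IH; rewrite ltnS leq_eqVlt => /orP[/eqP->//|/IH].
  by move/ltn_trans; apply.
move=> p; split=> [hp|[n ->]]; last exact/partnerP.
case: p hp => -[x y] /= xy hp.
have pE : exist _ (x, y) xy = pos x y :> position.
  by apply/val_inj => /=; congr pair; lia.
move: hp; rewrite pE => /partnerP yE.
have [i xE] : exists i, x = a i.
  by apply: (a_onto x.+1); [rewrite -yE | have := a_ge x.+1; lia].
by exists i; rewrite -xE -yE.
Qed.

(* Main.v *)
(* By [grundy_row_surj] and [grundy_row_inj], every number occurs in exactly one
   position of value k, so the pairs (a_n, b_n) partition the naturals (except
   that a_n = b_n is allowed).  A number below a_n must then occur in a pair
   whose smaller entry is below a_n, hence in an earlier pair, while a_n itself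
   occurs in no earlier pair. *)
Require Import Defs.
From mathcomp Require Import all_boot.
From mathcomp Require Import zify.

Lemma mex_unique (s : seq nat) (m : nat) :
  m \notin s -> (forall i, i < m -> i \in s) -> mex s = m.
Proof.
move=> ms lt_m; case: (ltngtP (mex s) m) => // [/lt_m|/lt_mex].
  by rewrite (negPf (mex_notin s)).
by rewrite (negPf ms).
Qed.

Lemma pos_inj (x y z w : nat) :
  pos x y = pos z w -> x = z /\ y = w \/ x = w /\ y = z.
Proof. by move=> /(congr1 val)[]; lia. Qed.

Theorem corollary11 (k : nat) (a b : nat -> nat)
    (hab : is_k_sequence k a b) (n : nat) :
  a n = mex ([seq a i | i <- iota 0 n] ++ [seq b i | i <- iota 0 n]).
Proof.
case: hab => le_ab a_mono seqP.
have grundy_ab i : grundy (pos (a i) (b i)) = k by apply/seqP; exists i.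
have lt_a i j : a i < a j -> i < j.
  by case: (ltngtP i j) => [//|/a_mono|->]; lia.
apply/esym/mex_unique => [|v v_lt].
  rewrite mem_cat negb_or; apply/andP; split; apply/mapP => -[i].
    by rewrite mem_iota add0n => /andP[_ /a_mono]; lia.
  rewrite mem_iota add0n => /andP[_ /a_mono lt_in] eq_ab.
  (* Since [a n = b i], both [a i] and [b n] complete [a n] to a position of value [k]. Injectivity
     along the row gives [a i = b n], against [a i < a n <= b n]. *)
  have := grundy_ab i; rewrite -(grundy_ab n) posC -eq_ab => /grundy_row_inj.
  by have := le_ab n; lia.
have [y /eqP/seqP[i /pos_inj v_i]] := grundy_row_surj k v.
(* Whichever entry of the pair [v] is, [a i <= v < a n] because [a i] is the smaller one; so the
   pair comes before the [n]-th. *)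
have i_lt : i \in iota 0 n.
  by rewrite mem_iota /= add0n; apply: lt_a; have := le_ab i; lia.
by rewrite mem_cat; case: v_i => -[-> _]; rewrite map_f ?orbT.
Qed.
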